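(* Let $\mathcal S=\{S_i,\ i\in J\}$ and $\mathcal S'=\{S'_i,\ i\in J\}$, $J=\{1,\dots,m\}$, be self-similar Jordan zippers in $\mathbb R^n$ with signatures $\bm\varepsilon,\bm\varepsilon'\in\{0,1\}^m$, whose attractors $\gamma$ and $\gamma'$ are Jordan arcs of bounded turning. Let $p_i$ (resp. $q_i$) be the similarity ratio of $S_i$ (resp. $S'_i$), $i\in J$. Then $\mathcal S$ and $\mathcal S'$ are bi-Hölder isomorphic if and only if $\bm\varepsilon=\bm\varepsilon'$. Moreover, in this case, the Hölder exponents of the homeomorphism $f:\gamma\to\gamma'$ that agrees with $\mathcal S$ and $\mathcal S'$ and of its inverse $f^{-1}$ are greater than or equal to $$\alpha=\min\left\{\frac{\log p_i}{\log q_i},\ \frac{\log q_i}{\log p_i}\ :\ i\in J\right\},$$ i.e. $f$ and $f^{-1}$ are Hölder continuous with exponent $\alpha$.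
   Context: A system $\mathcal S=\{S_i,\ i\in J\}$, $J=\{1,\dots,m\}$, of contracting similarities of $\mathbb R^n$ (ratios in $(0,1)$) is a self-similar zipper with vertices $\{z_0,\dots,z_m\}\subset\mathbb R^n$ and signature $\bm\varepsilon=(\varepsilon_1,\dots,\varepsilon_m)\in\{0,1\}^m$ if for every $i\in J$, $S_i(z_0)=z_{i-1+\varepsilon_i}$ and $S_i(z_m)=z_{i-\varepsilon_i}$. Its attractor is the (unique nonempty) compact set $K=K(\mathcal S)$ with $K=S_1(K)\cup\dots\cup S_m(K)$. If $0=t_0<t_1<\dots<t_m=1$, a self-similar zipper $\mathcal T=\{T_1,\dots,T_m\}$ in $\mathbb R$ with vertices $\{t_0,\dots,t_m\}$ and some signature is called linear; its attractor is $I=[0,1]$. For any zipper $\mathcal S$ with vertices $\{z_0,\dots,z_m\}$ and any linear zipper $\mathcal T$ with the same signature, there is a unique continuous map $g:I\to K(\mathcal S)$ with $g(t_i)=z_i$ for all $i$ and $S_i\circ g=g\circ T_i$ for every $i\in J$; moreover $g(I)=K(\mathcal S)$. Such maps $g$ are called structural parametrizations of the attractor. $\mathcal S$ is a Jordan zipper if one (equivalently, any) structural parametrization is a homeomorphism of $I$ onto $K(\mathcal S)$. A Jordan arc $\gamma\subset\mathbb R^n$ is an arc of bounded turning if there is $M>0$ such that for any $x,y\in\gamma$ the diameter of the subarc $\gamma_{xy}\subset\gamma$ with endpoints $x,y$ is at most $M\|x-y\|$. For self-similar Jordan zippers $\mathcal S=\{S_i,\ i\in J\}$ and $\mathcal S'=\{S'_i,\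 i\in J\}$ with attractors $\gamma,\gamma'$, a homeomorphism $f:\gamma\to\gamma'$ agrees with $\mathcal S$ and $\mathcal S'$ if $f\circ S_i=S'_i\circ f$ on $\gamma$ for every $i\in J$; then $f$ is said to define an isomorphism of the zippers. If the signatures are equal, there is a unique homeomorphism agreeing with $\mathcal S$ and $\mathcal S'$. The zippers $\mathcal S$ and $\mathcal S'$ are bi-Hölder isomorphic if there is a homeomorphism $f$ agreeing with $\mathcal S$ and $\mathcal S'$ that is bi-Hölder, i.e. both $f$ and $f^{-1}$ are Hölder continuous with some positive exponents. *)

(* Defs.v *)
From HB Require Import structures.
From mathcomp Require Import all_boot all_order all_algebra.
From mathcomp Require Import all_classical all_reals all_analysis.

Set Implicit Arguments.
Unset Strict Implicit.
Unset Printing Implicit Defensive.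

Import Order.TTheory GRing.Theory Num.Theory.
Import numFieldNormedType.Exports.

Local Open Scope classical_set_scope.
Local Open Scope ring_scope.

(* MathComp-Analysis only provides the sup norm on 'rV[R]_n, whereas similarity
   is a Euclidean notion. Both norms induce the library topology of 'rV[R]_n,
   which is the one used below for compactness and continuity. *)
Definition eucl_dist (R : realType) (n : nat) (x y : 'rV[R]_n) : R :=
  Num.sqrt (\sum_(i < n) (x 0 i - y 0 i) ^+ 2).

Definition rdist (R : realType) (s t : R) : R := `|s - t|.

(* The ambient space is a type X with a distance d, so that the same definition
   covers zippers in R^n (d := eucl_dist) and linear zippers in R (d := rdist).
   Indices are 0-based: the i-th map (i < m) is S_{i+1} of the usual indexing,
   so that z_{(i+1)-1+eps} = z_{i+eps} and z_{(i+1)-eps} = z_{i+1-eps}. *)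
Record zipper (R : realType) (X : Type) (d : X -> X -> R) (m : nat) := Zipper {
  zmap : 'I_m -> X -> X;
  sim_ratio : 'I_m -> R;
  vertex : 'I_m.+1 -> X;
  signature : {ffun 'I_m -> bool};
  sim_ratio_bounds : forall i, 0 < sim_ratio i < 1;
  zmap_similarity : forall i x y, d (zmap i x) (zmap i y) = sim_ratio i * d x y;
  zmap_first : forall i : 'I_m,
    zmap i (vertex ord0) = vertex (inord (i + signature i));
  zmap_last : forall i : 'I_m,
    zmap i (vertex ord_max) = vertex (inord (i.+1 - signature i))
}.

Definition is_attractor (R : realType) (n m : nat)
    (S : zipper (@eucl_dist R n) m) (K : set 'rV[R]_n) : Prop :=
  [/\ K !=set0, compact K & K = \bigcup_(i in [set: 'I_m]) (zmap S i @` K)].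

Definition is_linear (R : realType) (m : nat) (T : zipper (@rdist R) m) : Prop :=
  [/\ vertex T ord0 = 0, vertex T ord_max = 1 &
      forall i j : 'I_m.+1, (i < j)%N -> vertex T i < vertex T j].

(* f restricts to a homeomorphism of A onto B, with inverse g; only the values of
   f on A and of g on B matter. *)
Definition homeo (X Y : topologicalType) (A : set X) (B : set Y)
    (f : X -> Y) (g : Y -> X) : Prop :=
  [/\ (forall x, A x -> B (f x) /\ g (f x) = x),
      (forall y, B y -> A (g y) /\ f (g y) = y),
      {within A, continuous f} & {within B, continuous g}].

Definition structural_parametrization (R : realType) (n m : nat)
    (S : zipper (@eucl_dist R n) m) (T : zipper (@rdist R) m)
    (g : R -> 'rV[R]_n) : Prop :=
  [/\ is_linear T,
      signature T = signature S,
      {within `[0, 1], continuous g},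
      (forall i, g (vertex T i) = vertex S i) &
      (forall i t, t \in `[0, 1] -> zmap S i (g t) = g (zmap T i t))].

Definition jordan_zipper (R : realType) (n m : nat)
    (S : zipper (@eucl_dist R n) m) (gamma : set 'rV[R]_n) : Prop :=
  exists (T : zipper (@rdist R) m) (g : R -> 'rV[R]_n) (h : 'rV[R]_n -> R),
    structural_parametrization S T g /\ homeo (`[0, 1] : set R) gamma g h.

Definition jordan_arc (R : realType) (n : nat) (gamma : set 'rV[R]_n) : Prop :=
  exists (g : R -> 'rV[R]_n) (h : 'rV[R]_n -> R), homeo (`[0, 1] : set R) gamma g h.

Definition subarc (R : realType) (n : nat) (gamma : set 'rV[R]_n)
    (x y : 'rV[R]_n) (A : set 'rV[R]_n) : Prop :=
  exists (g : R -> 'rV[R]_n) (h : 'rV[R]_n -> R) (s t : R),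
    [/\ homeo (`[0, 1] : set R) gamma g h, 0 <= s <= t /\ t <= 1,
        g s = x, g t = y & A = g @` `[s, t]].

Definition diam (R : realType) (n : nat) (A : set 'rV[R]_n) : \bar R :=
  ereal_sup [set (eucl_dist x.1 x.2)%:E | x in A `*` A].

Definition bounded_turning (R : realType) (n : nat) (gamma : set 'rV[R]_n) : Prop :=
  exists2 M : R, 0 < M & forall x y A, gamma x -> gamma y ->
    subarc gamma x y A -> (diam A <= (M * eucl_dist x y)%:E)%E.

Definition holder (R : realType) (n : nat) (a : R) (A : set 'rV[R]_n)
    (f : 'rV[R]_n -> 'rV[R]_n) : Prop :=
  0 < a /\ exists2 C : R, 0 < C & forall x y, A x -> A y ->
    eucl_dist (f x) (f y) <= C * eucl_dist x y `^ a.

Definition agrees (R : realType) (n m : nat) (S S' : zipper (@eucl_dist R n) m)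
    (gamma : set 'rV[R]_n) (f : 'rV[R]_n -> 'rV[R]_n) : Prop :=
  forall i x, gamma x -> f (zmap S i x) = zmap S' i (f x).

Definition bi_holder_isomorphic (R : realType) (n m : nat)
    (S S' : zipper (@eucl_dist R n) m) (gamma gamma' : set 'rV[R]_n) : Prop :=
  exists f g : 'rV[R]_n -> 'rV[R]_n,
    [/\ homeo gamma gamma' f g, agrees S S' gamma f,
        (exists a : R, holder a gamma f) &
        (exists b : R, holder b gamma' g)].

(* The default value 1 of the iterated minimum is harmless: for p, q in (0,1) the
   quotient ln p / ln q and its inverse are positive, so one of them is <= 1. *)
Definition holder_exponent (R : realType) (m : nat) (p q : 'I_m -> R) : R :=
  \big[Num.min/1]_(i < m) Num.min (ln (p i) / ln (q i)) (ln (q i) / ln (p i)).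

(* Main.v *)
Require Import Defs.
From mathcomp Require Import all_boot all_order all_algebra.
From mathcomp Require Import all_classical all_reals all_analysis.
From mathcomp Require Import ring lra.

(** Choose structural parametrizations g of gamma and g' of gamma', with linear
    zippers T and T'. The whole argument takes place on the unit interval.

    Hölder estimate. If f agrees with S and S', then G = f o g satisfies
    S'_i o G = G o T_i, while S_i o g = g o T_i. The inequality
    d(G s, G t) <= C d(g s, g t)^alpha is inherited from (s, t) by (T_i s, T_i t):
    the left side is multiplied by q_i, the right one by p_i^alpha, and the choice
    of alpha gives q_i <= p_i^alpha ([ratio_le_powR_exponent]). So a pair can be
    enlarged until its two parameters lie in no common piece T_i[0,1]; they are
    then separated by a vertex, and bounded turning allows to treat the pairs
    (s, v) and (v, t) instead of (s, t). A pair (s, v) with v a vertex is enlarged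
    in the same way, until a whole piece lies between s and v; then bounded turning
    gives a lower bound for d(g s, g v), and the inequality holds because gamma'
    is bounded ([holder_of_intertwining]). As alpha is symmetric in p and q, the
    same estimate with the roles exchanged applies to the inverse of f.

    Existence of f. When the signatures agree, the operator that sends psi to the
    function equal to T'_i o psi o T_i^-1 on the i-th piece is well defined on
    functions fixing 0 and 1, and it is a contraction; its fixed point conjugates T
    to T' ([linear_conjugation_exists]). Only the identity conjugates T to itself
    ([linear_selfconjugation_unique]), hence psi is a bijection whose inverse is
    obtained by exchanging T and T', and f = g' o psi o g^-1 is a bijection
    agreeing with S and S'. Its continuity and that of its inverse follow from the
    Hölder estimate.

    Necessity of equal signatures. If f is a homeomorphism agreeing with S and S',
    then phi = g'^-1 o f o g is a monotone conjugation of T and T'. Conjugation by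
    a monotone map, increasing or not, preserves the orientation of T_i, and the
    signature records this orientation ([signature_eq_of_conjugation]). *)

Set Implicit Arguments.
Unset Strict Implicit.
Unset Printing Implicit Defensive.

Import Order.TTheory GRing.Theory Num.Theory.
Import numFieldNormedType.Exports.

Local Open Scope classical_set_scope.
Local Open Scope ring_scope.

(** * Euclidean distance *)

Lemma eucl_dist_ge0 (R : realType) (n : nat) (x y : 'rV[R]_n) :
  0 <= eucl_dist x y.
Proof. exact: sqrtr_ge0. Qed.

Lemma eucl_distxx (R : realType) (n : nat) (x : 'rV[R]_n) : eucl_dist x x = 0.
Proof.
by rewrite /eucl_dist big1 ?sqrtr0// => i _; rewrite subrr expr0n.
Qed.

Lemma eucl_distC (R : realType) (n : nat) (x y : 'rV[R]_n) :
  eucl_dist x y = eucl_dist y x.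
Proof.
by congr Num.sqrt; apply: eq_bigr => i _; rewrite -sqrrN opprB.
Qed.

Lemma eucl_dist_le (R : realType) (n : nat) (x y : 'rV[R]_n) (b : R) : 0 <= b ->
  (eucl_dist x y <= b) = (\sum_(i < n) (x 0 i - y 0 i) ^+ 2 <= b ^+ 2).
Proof.
by move=> b0; rewrite -[in LHS](ger0_norm b0) -sqrtr_sqr ler_sqrt ?sqr_ge0.
Qed.

(** The constant 2 (instead of the triangle inequality) comes from
    (a + b)^2 <= 2 a^2 + 2 b^2 in each coordinate; multiplicative constants
    are irrelevant for Hölder estimates. *)
Lemma eucl_dist_weak_triangle (R : realType) (n : nat) (x y z : 'rV[R]_n) (b : R) :
  eucl_dist x y <= b -> eucl_dist y z <= b -> eucl_dist x z <= 2 * b.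
Proof.
move=> xy yz; have b0 : 0 <= b by apply: le_trans xy; exact: eucl_dist_ge0.
move: xy yz; rewrite !eucl_dist_le ?mulr_ge0// => xy yz.
have : \sum_(i < n) (x 0 i - z 0 i) ^+ 2 <=
    2 * (\sum_(i < n) (x 0 i - y 0 i) ^+ 2 + \sum_(i < n) (y 0 i - z 0 i) ^+ 2).
  rewrite -big_split/= mulr_sumr; apply: ler_sum => i _.
  have := sqr_ge0 (x 0 i - 2 * y 0 i + z 0 i); nra.
nra.
Qed.

Lemma normr_le_eucl_dist (R : realType) (n : nat) (x y : 'rV[R]_n) :
  `|x - y| <= eucl_dist x y.
Proof.
rewrite [leLHS]mx_normrE; apply: bigmax_le => [|[i j] _] /=.
  exact: eucl_dist_ge0.
rewrite ord1 !mxE -sqrtr_sqr ler_sqrt ?sumr_ge0// => [|k _]; last exact: sqr_ge0.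
by rewrite (bigD1 j)//= lerDl sumr_ge0// => k _; exact: sqr_ge0.
Qed.

Lemma eucl_dist_le_normr (R : realType) (n : nat) (x y : 'rV[R]_n) :
  eucl_dist x y <= Num.sqrt n%:R * `|x - y|.
Proof.
rewrite eucl_dist_le ?mulr_ge0 ?sqrtr_ge0// exprMn sqr_sqrtr//.
rewrite mulr_natl -[X in _ *+ X](card_ord n) -sumr_const; apply: ler_sum => i _.
rewrite -[leLHS]real_normK ?num_real// lerXn2r ?nnegrE//.
rewrite [leRHS]mx_normrE (le_trans _ (le_bigmax _ _ (0, i)))//= !mxE//.
Qed.

Lemma eucl_dist_gt0 (R : realType) (n : nat) (x y : 'rV[R]_n) :
  x != y -> 0 < eucl_dist x y.
Proof.
move=> xy; apply: lt_le_trans (normr_le_eucl_dist _ _).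
by rewrite normr_gt0 subr_eq0.
Qed.

Lemma compact_eucl_bounded (R : realType) (n : nat) (A : set 'rV[R]_n) :
  compact A -> exists2 D : R, 0 < D &
    forall x y, A x -> A y -> eucl_dist x y <= D.
Proof.
move=> /compact_bounded[M [_ HM]].
have {}HM : forall x, A x -> `|x| <= `|M| + 1.
  by apply: HM; rewrite (le_lt_trans (ler_norm _))// ltrDl.
exists (Num.sqrt n%:R * (2 * (`|M| + 1)) + 1) => [|x y /HM Ax /HM Ay].
  by rewrite ltr_wpDl// mulr_ge0 ?sqrtr_ge0// mulr_ge0// addr_ge0.
apply: le_trans (eucl_dist_le_normr _ _) _.
apply: (@le_trans _ _ (Num.sqrt n%:R * (2 * (`|M| + 1)))); last by rewrite lerDl.
rewrite ler_wpM2l ?sqrtr_ge0// (le_trans (ler_normB _ _))//; lra.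
Qed.

(** * Powers of a ratio *)

Lemma expr_lt_eps (R : realType) (rho e : R) :
  0 <= rho < 1 -> 0 < e -> exists k, rho ^+ k < e.
Proof.
move=> /andP[r0 r1] e0.
have : (rho ^+ k @[k --> \oo] --> (0 : R))%classic.
  by apply: cvg_expr; rewrite ger0_norm.
move=> /cvgr_lt /(_ e e0) [k _ Hk]; exists k; exact: (Hk k (leqnn k)).
Qed.

Lemma eq_of_le_expr (R : realType) (rho c x y : R) : 0 <= rho < 1 -> 0 < c ->
  (forall k, `|x - y| <= c * rho ^+ k) -> x = y.
Proof.
move=> r01 c0 H; apply/eqP; rewrite -subr_eq0 -normr_eq0; apply/eqP.
apply/le_anti; rewrite normr_ge0 andbT leNgt; apply/negP => xy.
have [k] := expr_lt_eps r01 (divr_gt0 xy c0).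
by rewrite ltr_pdivlMr// mulrC ltNge H.
Qed.

Lemma sim_ratio_lt1_unif (R : realType) (X : Type) (d : X -> X -> R) (m : nat)
    (S : zipper d m) :
  exists2 rho : R, 0 <= rho < 1 & forall i, sim_ratio S i <= rho.
Proof.
exists (\big[Num.max/0]_(i < m) sim_ratio S i) => [|i]; last exact: le_bigmax.
rewrite bigmax_ge_id /=; apply: bigmax_lt => // i _.
by have /andP[] := sim_ratio_bounds S i.
Qed.

(** * Linear zippers *)

Definition piece_lo (R : realType) (m : nat) (T : zipper (@rdist R) m)
  (i : 'I_m) : R := vertex T (inord i).
Definition piece_hi (R : realType) (m : nat) (T : zipper (@rdist R) m)
  (i : 'I_m) : R := vertex T (inord i.+1).

Lemma linear_vertex_le (R : realType) (m : nat) (T : zipper (@rdist R) m)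
    (i j : 'I_m.+1) : is_linear T -> (i <= j)%N -> vertex T i <= vertex T j.
Proof.
move=> [_ _ lt_T]; rewrite leq_eqVlt => /orP[/eqP/val_inj->//|/lt_T]; exact: ltW.
Qed.

Lemma linear_vertex01 (R : realType) (m : nat) (T : zipper (@rdist R) m)
    (k : 'I_m.+1) : is_linear T -> 0 <= vertex T k <= 1.
Proof.
move=> lT; have [T0 T1 _] := lT; rewrite -T0 -T1.
by rewrite !linear_vertex_le// -ltnS.
Qed.

Lemma piece_lt (R : realType) (m : nat) (T : zipper (@rdist R) m) (i : 'I_m) :
  is_linear T -> piece_lo T i < piece_hi T i.
Proof.
move=> [_ _ lt_T]; apply: lt_T; rewrite !inordK ?ltnS//.
by rewrite ltnW.
Qed.

Lemma piece_disjoint (R : realType) (m : nat) (T : zipper (@rdist R) m)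
    (i j : 'I_m) : is_linear T -> (i < j)%N -> piece_hi T i <= piece_lo T j.
Proof.
move=> lT ij; apply: linear_vertex_le => //.
by rewrite !inordK ?ltnS// ltnW.
Qed.

Lemma piece_adjacent (R : realType) (m : nat) (T : zipper (@rdist R) m)
    (i j : 'I_m) :
  is_linear T -> (i < j)%N -> piece_hi T i = piece_lo T j -> i.+1 = j.
Proof.
move=> [_ _ lt_T] ij hl; apply/eqP; rewrite eqn_leq ij leqNgt; apply/negP => ij1.
have := lt_T (inord i.+1) (inord j); rewrite !inordK ?ltnS//; last by rewrite ltnW.
by move=> /(_ ij1); rewrite -/(piece_hi T i) -/(piece_lo T j) hl ltxx.
Qed.

Lemma linear_zmap0 (R : realType) (m : nat) (T : zipper (@rdist R) m) (i : 'I_m) :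
  is_linear T ->
  zmap T i 0 = if signature T i then piece_hi T i else piece_lo T i.
Proof.
move=> [T0 _ _]; rewrite -T0 zmap_first.
by case: (signature T i); rewrite ?addn1 ?addn0.
Qed.

Lemma linear_zmap1 (R : realType) (m : nat) (T : zipper (@rdist R) m) (i : 'I_m) :
  is_linear T ->
  zmap T i 1 = if signature T i then piece_lo T i else piece_hi T i.
Proof.
move=> [_ T1 _]; rewrite -T1 zmap_last.
by case: (signature T i); rewrite ?subn1 ?subn0.
Qed.

(** A similarity of the line is determined by the images of 0 and 1: the distances
    of the image of t to both of them fix its position. *)
Lemma rdist_zmap_affine (R : realType) (m : nat) (T : zipper (@rdist R) m)
    (i : 'I_m) (t : R) : 0 <= t <= 1 ->
  zmap T i t = zmap T i 0 + (zmap T i 1 - zmap T i 0) * t.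
Proof.
move=> /andP[t0 t1]; have /andP[r0 _] := sim_ratio_bounds T i.
have := zmap_similarity T i t 0; have := zmap_similarity T i t 1.
have := zmap_similarity T i 1 0; rewrite /rdist.
rewrite !subr0 normr1 mulr1 [`|t|]ger0_norm// [`|t - 1|]distrC [`|1 - t|]ger0_norm ?subr_ge0//.
set A := zmap T i 0; set B := zmap T i 1; set X := zmap T i t.
set r := sim_ratio T i in r0 *.
have rt0 : 0 <= r * t by rewrite mulr_ge0// ltW.
have rt1 : r * t <= r by rewrite ler_piMr// ltW.
have [BA|BA] := lerP 0 (B - A).
  rewrite ger0_norm// => BAr; rewrite BAr; have [XB|XB] := lerP 0 (X - B).
    by rewrite ger0_norm//; have [XA|XA] := lerP 0 (X - A);
      rewrite ?(ger0_norm XA) ?(ltr0_norm XA); lra.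
  by rewrite ltr0_norm//; have [XA|XA] := lerP 0 (X - A);
      rewrite ?(ger0_norm XA) ?(ltr0_norm XA); lra.
rewrite ltr0_norm// => BAr; rewrite (_ : B - A = - r); last by lra.
have [XB|XB] := lerP 0 (X - B).
  by rewrite ger0_norm//; have [XA|XA] := lerP 0 (X - A);
    rewrite ?(ger0_norm XA) ?(ltr0_norm XA); lra.
by rewrite ltr0_norm//; have [XA|XA] := lerP 0 (X - A);
    rewrite ?(ger0_norm XA) ?(ltr0_norm XA); lra.
Qed.

Lemma linear_zmap_piece (R : realType) (m : nat) (T : zipper (@rdist R) m)
    (i : 'I_m) (t : R) : is_linear T -> 0 <= t <= 1 ->
  piece_lo T i <= zmap T i t <= piece_hi T i.
Proof.
move=> lT t01; rewrite rdist_zmap_affine// linear_zmap0// linear_zmap1//.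
have := piece_lt i lT; move: t01 => /andP[t0 t1] lh.
by case: (signature T i); nra.
Qed.

Lemma linear_zmap01 (R : realType) (m : nat) (T : zipper (@rdist R) m)
    (i : 'I_m) (t : R) : is_linear T -> 0 <= t <= 1 -> 0 <= zmap T i t <= 1.
Proof.
move=> lT t01; have /andP[a b] := linear_zmap_piece i lT t01.
have /andP[a0 _] := linear_vertex01 (inord i) lT.
have /andP[_ b1] := linear_vertex01 (inord i.+1) lT.
by rewrite (le_trans a0 a) (le_trans b b1).
Qed.

Lemma piece_zmap (R : realType) (m : nat) (T : zipper (@rdist R) m)
    (i : 'I_m) (s : R) : is_linear T -> piece_lo T i <= s <= piece_hi T i ->
  exists2 t, 0 <= t <= 1 & s = zmap T i t.
Proof.
move=> lT /andP[ls sh]; have lh := piece_lt i lT.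
have lh0 : 0 < piece_hi T i - piece_lo T i by rewrite subr_gt0.
have [e|e] := boolP (signature T i).
- have t01 : 0 <= (piece_hi T i - s) / (piece_hi T i - piece_lo T i) <= 1.
    by rewrite divr_ge0 ?ler_pdivrMr ?mul1r//; lra.
  exists ((piece_hi T i - s) / (piece_hi T i - piece_lo T i)) => //.
  rewrite rdist_zmap_affine// linear_zmap0// linear_zmap1// e.
  by field; rewrite gt_eqF.
- have t01 : 0 <= (s - piece_lo T i) / (piece_hi T i - piece_lo T i) <= 1.
    by rewrite divr_ge0 ?ler_pdivrMr ?mul1r//; lra.
  exists ((s - piece_lo T i) / (piece_hi T i - piece_lo T i)) => //.
  rewrite rdist_zmap_affine// linear_zmap0// linear_zmap1// (negbTE e).
  by field; rewrite gt_eqF.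
Qed.

Lemma linear_gt0 (R : realType) (m : nat) (T : zipper (@rdist R) m) :
  is_linear T -> (0 < m)%N.
Proof.
case: m T => // T [T0 T1 _]; have := oner_neq0 R.
by rewrite -T1 (ord1 ord_max) -T0 eqxx.
Qed.

Lemma piece_cover (R : realType) (m : nat) (T : zipper (@rdist R) m) (s : R) :
  is_linear T -> 0 <= s <= 1 -> exists i, piece_lo T i <= s <= piece_hi T i.
Proof.
move=> lT /andP[s0 s1]; have m0 := linear_gt0 lT; have [T0 T1 _] := lT.
have H k : (k < m)%N -> s <= vertex T (inord k.+1) ->
    exists i, piece_lo T i <= s <= piece_hi T i.
  elim: k => [|k IH] km sk.
    exists (Ordinal km); rewrite /piece_lo /piece_hi /= sk andbT.
    suff -> : inord 0 = ord0 :> 'I_m.+1 by rewrite T0.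
    by apply: val_inj; rewrite /= inordK.
  have [sk'|sk'] := lerP s (vertex T (inord k.+1)); first exact: IH (ltnW km) sk'.
  by exists (Ordinal km); rewrite /piece_lo /piece_hi /= sk ltW.
apply: (H m.-1); rewrite ?prednK//.
suff -> : inord m = ord_max :> 'I_m.+1 by rewrite T1.
by apply: val_inj; rewrite /= inordK.
Qed.

Lemma linear_cover (R : realType) (m : nat) (T : zipper (@rdist R) m) (s : R) :
  is_linear T -> 0 <= s <= 1 ->
  exists i t, 0 <= t <= 1 /\ s = zmap T i t.
Proof.
move=> lT /(piece_cover lT)[i /(piece_zmap lT)[t t01 ->]]; by exists i, t.
Qed.

Lemma linear_zmap_end (R : realType) (m : nat) (T : zipper (@rdist R) m)
    (i : 'I_m) (e : bool) : is_linear T ->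
  zmap T i e%:R = if e (+) signature T i then piece_hi T i else piece_lo T i.
Proof.
move=> lT; case: e => /=; last exact: linear_zmap0.
by rewrite linear_zmap1//; case: (signature T i).
Qed.

(** This prepares the zooming towards a vertex v: among the pieces ending at v, take
    the one on the side of s; when it does not contain s, it separates s from v. *)
Lemma vertex_side (R : realType) (m : nat) (T : zipper (@rdist R) m) (s : R)
    (k : 'I_m.+1) : is_linear T -> 0 <= s <= 1 -> s != vertex T k ->
  exists (i : 'I_m) (e : bool), vertex T k = zmap T i e%:R /\
    [\/ piece_lo T i <= s <= piece_hi T i,
        s <= piece_lo T i /\ piece_hi T i = vertex T k |
        piece_hi T i <= s /\ piece_lo T i = vertex T k].
Proof.
move=> lT /andP[s0 s1]; have [T0 T1 _] := lT.
rewrite neq_lt => /orP[sv|vs].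
- have k0 : (0 < k)%N.
    rewrite lt0n; apply/eqP => k0; move: sv.
    by rewrite (_ : k = ord0) ?T0 ?ltNge ?s0//; exact: val_inj.
  have km : (k.-1 < m)%N by rewrite prednK// -ltnS.
  have hk : piece_hi T (Ordinal km) = vertex T k.
    by rewrite /piece_hi /= prednK// inord_val.
  (* the piece to the left of v, and the end of the unit interval it sends to v *)
  exists (Ordinal km), (~~ signature T (Ordinal km)); split.
    by rewrite -hk linear_zmap_end//; case: (signature T _).
  have [ls|sl] := lerP (piece_lo T (Ordinal km)) s.
    by constructor 1; rewrite hk (ltW sv).
  by constructor 2; rewrite (ltW sl).
- have km : (k < m)%N.
    rewrite ltn_neqAle -ltnS ltn_ord andbT; apply/eqP => k0; move: vs.
    by rewrite (_ : k = ord_max) ?T1 ?ltNge ?s1//; exact: val_inj.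
  have hk : piece_lo T (Ordinal km) = vertex T k.
    by rewrite /piece_lo /= inord_val.
  exists (Ordinal km), (signature T (Ordinal km)); split.
    by rewrite -hk linear_zmap_end//; case: (signature T _).
  have [sh|hs] := lerP s (piece_hi T (Ordinal km)).
    by constructor 1; rewrite hk (ltW vs).
  by constructor 3; rewrite (ltW hs).
Qed.

Lemma bool01 (R : realType) (e : bool) : 0 <= (e%:R : R) <= 1.
Proof. by case: e; rewrite ?lexx ?ler01. Qed.

Lemma rdist_zmap_dist (R : realType) (m : nat) (T : zipper (@rdist R) m) (i : 'I_m)
  (s t : R) : `|zmap T i s - zmap T i t| = sim_ratio T i * `|s - t|.
Proof. exact: zmap_similarity. Qed.

(** * Hölder estimate along a parametrization *)

Section holder_estimate.
Context (R : realType) (n m : nat) (S S' : zipper (@eucl_dist R n) m).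
Context (T : zipper (@rdist R) m) (g G : R -> 'rV[R]_n) (M D a : R).
Context (lT : is_linear T).
Context (gT : forall i (t : R), 0 <= t <= 1 -> zmap S i (g t) = g (zmap T i t)).
Context (GT : forall i (t : R), 0 <= t <= 1 -> zmap S' i (G t) = G (zmap T i t)).
Context (M0 : 0 < M) (D0 : 0 < D) (a0 : 0 < a).
Context (turning : forall (s s' t' t : R), 0 <= s -> s <= s' -> s' <= t' -> t' <= t ->
  t <= 1 -> eucl_dist (g s') (g t') <= M * eucl_dist (g s) (g t)).
Context (G_bounded : forall s t : R, 0 <= s <= 1 -> 0 <= t <= 1 ->
  eucl_dist (G s) (G t) <= D).
Context (ratio_le : forall i, sim_ratio S' i <= sim_ratio S i `^ a).
Context (g01 : g 0 != g 1).

Let holder_pair (C s t : R) : Prop :=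
  eucl_dist (G s) (G t) <= C * eucl_dist (g s) (g t) `^ a.

Let holder_pairC C s t : holder_pair C s t -> holder_pair C t s.
Proof. by rewrite /holder_pair eucl_distC [eucl_dist (g s) _]eucl_distC. Qed.

Let powR_base_le (x y : R) : 0 <= x -> x <= y -> x `^ a <= y `^ a.
Proof.
move=> x0 xy; apply: (ge0_ler_powR (ltW a0)) => //; rewrite nnegrE //.
exact: le_trans xy.
Qed.

Let holder_pair_zmap C i s t : 0 <= C -> 0 <= s <= 1 -> 0 <= t <= 1 ->
  holder_pair C s t -> holder_pair C (zmap T i s) (zmap T i t).
Proof.
move=> C0 s01 t01; rewrite /holder_pair -!gT// -!GT// !zmap_similarity.
have /andP[p0 _] := sim_ratio_bounds S i; have /andP[q0 _] := sim_ratio_bounds S' i.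
rewrite (powRM _ (ltW p0) (eucl_dist_ge0 _ _)) => h.
apply: le_trans (ler_wpM2l (ltW q0) h) _.
by rewrite mulrCA (ler_wpM2l C0)// ler_wpM2r ?powR_ge0.
Qed.

(** Bounded turning bounds the distance of g s and g t from below as soon as a
    whole piece lies between s and t. *)
Let holder_pair_piece : exists2 C, 0 < C & forall i (s t : R), 0 <= s ->
  s <= piece_lo T i -> piece_hi T i <= t -> t <= 1 -> holder_pair C s t.
Proof.
pose p := \big[Num.min/1]_(i < m) sim_ratio S i.
have p0 : 0 < p.
  by apply: lt_bigmin => // i _; have /andP[] := sim_ratio_bounds S i.
(* the size of the smallest image piece, divided by the turning constant *)
pose c := p * eucl_dist (g 0) (g 1) / M.
have c0 : 0 < c by rewrite divr_gt0// mulr_gt0// eucl_dist_gt0.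
exists (D / c `^ a) => [|i s t s0 sl ht t1]; first by rewrite divr_gt0// powR_gt0.
have lh := ltW (piece_lt i lT).
have st : s <= t by rewrite (le_trans sl)// (le_trans lh).
have s01 : 0 <= s <= 1 by rewrite s0 (le_trans st).
have t01 : 0 <= t <= 1 by rewrite t1 (le_trans s0).
have cst : c <= eucl_dist (g s) (g t).
  rewrite ler_pdivrMr// mulrC [leRHS]mulrC.
  apply: le_trans (turning s0 sl lh ht t1).
  have -> : eucl_dist (g (piece_lo T i)) (g (piece_hi T i)) =
      sim_ratio S i * eucl_dist (g 0) (g 1).
    rewrite -zmap_similarity !gT ?lexx ?ler01// linear_zmap0// linear_zmap1//.
    by case: ifP => // _; rewrite eucl_distC.
  by rewrite mulrC ler_wpM2r ?eucl_dist_ge0//; exact: bigmin_le.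
apply: le_trans (G_bounded s01 t01) _.
rewrite mulrAC ler_pdivlMr ?powR_gt0// (ler_wpM2l (ltW D0))//.
by apply: powR_base_le => //; exact: ltW.
Qed.

(** One step of zooming towards a vertex v: [holder_pair_piece] applies unless s
    lies in the piece next to v, and then T_i^-1 sends v to an endpoint of the unit
    interval, which is again a vertex. *)
Let holder_pair_vertex_step : exists2 C, 0 < C &
  forall s k, 0 <= s <= 1 -> s != vertex T k ->
  holder_pair C s (vertex T k) \/
  exists i s' (e : bool), [/\ 0 <= s' <= 1, s = zmap T i s',
    vertex T k = zmap T i e%:R & forall C', 0 <= C' ->
    holder_pair C' s' e%:R -> holder_pair C' s (vertex T k)].
Proof.
have [C C0 HC] := holder_pair_piece; exists C => // s k s01 sv.
have /andP[s0 s1] := s01; have /andP[v0 v1] := linear_vertex01 k lT.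
have [i [e [ve [sp|[sl hv]|[hs lv]]]]] := vertex_side lT s01 sv.
- right; have [s' s'01 ss'] := piece_zmap lT sp.
  exists i, s', e; split=> // C' C'0 h; rewrite ss' ve.
  by apply: holder_pair_zmap => //; exact: bool01.
- by left; apply: (HC i); rewrite ?hv.
- by left; apply: holder_pairC; apply: (HC i); rewrite ?lv.
Qed.

(** The zooming of [holder_pair_vertex_step] stops, since each zoom multiplies the
    distance of the two parameters by at least 1 / rho and they stay in the unit
    interval; it can be iterated because 0 and 1 are themselves vertices. *)
Let holder_pair_vertex : exists2 C, 0 < C & forall s k, 0 <= s <= 1 ->
  holder_pair C s (vertex T k).
Proof.
have [C C0 step] := holder_pair_vertex_step; exists C => //.
have [rho rho01 hrho] := sim_ratio_lt1_unif T.
have [T0 T1 _] := lT.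
have end_vertex (e : bool) : exists k, e%:R = vertex T k.
  by case: e; [exists ord_max | exists ord0].
have H N s k : 0 <= s <= 1 -> rho ^+ N < `|s - vertex T k| ->
    holder_pair C s (vertex T k).
  elim: N s k => [|N IH] s k s01 far.
    move: far s01 (linear_vertex01 k lT); rewrite expr0 ltNge => /negP far.
    by move=> /andP[? ?] /andP[? ?]; case: far; rewrite ler_norml; lra.
  have sv : s != vertex T k.
    apply/eqP => sv; move: far; rewrite sv subrr normr0 ltNge exprn_ge0//.
    by have /andP[] := rho01.
  have [//|[i [s' [e [s'01 ss' ve]]]]] := step s k s01 sv; apply; first exact: ltW.
  have [l el] := end_vertex e; rewrite el; apply: IH => //; rewrite -el.
  move: far; rewrite ss' ve rdist_zmap_dist exprS => /lt_le_trans.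
  move=> /(_ _ (ler_wpM2r (normr_ge0 _) (hrho i))) far.
  have r0 : 0 < rho.
    by apply: lt_le_trans (hrho i); have /andP[] := sim_ratio_bounds T i.
  by move: far; rewrite ltr_pM2l.
move=> s k s01; have [->|sv] := eqVneq s (vertex T k).
  by rewrite /holder_pair !eucl_distxx powR0 ?gt_eqF// mulr0.
have [|N] := expr_lt_eps rho01 (_ : 0 < `|s - vertex T k|).
  by rewrite normr_gt0 subr_eq0.
exact: H.
Qed.

(** Zooming in, two parameters eventually lie in no common piece; then they are
    separated by a vertex v, and bounded turning compares the distances of g v to
    g s and g t with the distance of g s and g t. *)
Lemma holder_of_intertwining : exists2 C, 0 < C &
  forall s t, 0 <= s <= 1 -> 0 <= t <= 1 ->
  eucl_dist (G s) (G t) <= C * eucl_dist (g s) (g t) `^ a.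
Proof.
have [C C0 HC] := holder_pair_vertex; exists (2 * (C * M `^ a)).
  by rewrite !mulr_gt0// powR_gt0.
have CM0 : 0 <= 2 * (C * M `^ a) by rewrite !mulr_ge0 ?powR_ge0// ltW.
have [rho rho01 hrho] := sim_ratio_lt1_unif T.
have H N s t : 0 <= s <= 1 -> 0 <= t <= 1 -> s <= t -> rho ^+ N < `|s - t| ->
    holder_pair (2 * (C * M `^ a)) s t.
  elim: N s t => [|N IH] s t s01 t01 st far.
    move: far s01 t01; rewrite expr0 ltNge => /negP far.
    by move=> /andP[? ?] /andP[? ?]; case: far; rewrite ler_norml; lra.
  have [i /andP[ls sh]] := piece_cover lT s01.
  have [th|ht] := lerP t (piece_hi T i).
    have [s' s'01 ss'] : exists2 u, 0 <= u <= 1 & s = zmap T i u.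
      by apply: piece_zmap => //; rewrite ls.
    have [t' t'01 tt'] : exists2 u, 0 <= u <= 1 & t = zmap T i u.
      by apply: piece_zmap => //; rewrite th (le_trans ls).
    have {}far : rho ^+ N < `|s' - t'|.
      move: far; rewrite ss' tt' rdist_zmap_dist exprS => /lt_le_trans.
      move=> /(_ _ (ler_wpM2r (normr_ge0 _) (hrho i))).
      rewrite ltr_pM2l//.
      by apply: lt_le_trans (hrho i); have /andP[] := sim_ratio_bounds T i.
    rewrite ss' tt'; apply: holder_pair_zmap => //.
    have [s't'|/ltW t's'] := lerP s' t'; first exact: IH.
    by apply: holder_pairC; apply: IH; rewrite // distrC.
  have /andP[s0 s1] := s01; have /andP[t0 t1] := t01.
  have bound u v : 0 <= u <= 1 -> s <= u -> u <= t -> (v = s) \/ (v = t) ->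
      eucl_dist (g u) (g v) `^ a <= M `^ a * eucl_dist (g s) (g t) `^ a.
    move=> u01 su ut vst; rewrite -(powRM _ (ltW M0) (eucl_dist_ge0 _ _)).
    apply: powR_base_le; rewrite ?eucl_dist_ge0//.
    case: vst => ->; first by rewrite eucl_distC; exact: turning.
    exact: turning.
  (* s lies in the i-th piece and t beyond it, so v is the right end of that piece *)
  have v01 := linear_vertex01 (inord i.+1) lT.
  rewrite /holder_pair -!mulrA.
  apply: (@eucl_dist_weak_triangle _ _ _ (G (vertex T (inord i.+1)))).
    apply: le_trans (HC _ _ s01) _; rewrite ler_wpM2l ?(ltW C0)//.
    by rewrite eucl_distC; apply: bound => //; [exact: ltW | left].
  rewrite eucl_distC; apply: le_trans (HC _ _ t01) _; rewrite ler_wpM2l ?(ltW C0)//.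
  by rewrite eucl_distC; apply: bound => //; [exact: ltW | right].
have H' s t : 0 <= s <= 1 -> 0 <= t <= 1 -> s <= t ->
    holder_pair (2 * (C * M `^ a)) s t.
  move=> s01 t01 st; have [->|neq_st] := eqVneq s t.
    by rewrite /holder_pair !eucl_distxx powR0 ?gt_eqF// mulr0.
  have [|N] := expr_lt_eps rho01 (_ : 0 < `|s - t|).
    by rewrite normr_gt0 subr_eq0.
  exact: H.
move=> s t s01 t01; have [st|/ltW ts] := lerP s t; first exact: H'.
by apply: holder_pairC; exact: H'.
Qed.

End holder_estimate.

(** * Conjugating two linear zippers *)

Lemma rdist_zmap_inj (R : realType) (m : nat) (T : zipper (@rdist R) m)
    (i : 'I_m) : injective (zmap T i).
Proof.
move=> s t st; apply/eqP; rewrite -subr_eq0 -normr_eq0.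
have /andP[r0 _] := sim_ratio_bounds T i.
have := rdist_zmap_dist T i s t; rewrite st subrr normr0 => /esym/eqP.
by rewrite mulf_eq0 gt_eqF.
Qed.

Section linear_conjugation.
Context (R : realType) (m : nat) (T T' : zipper (@rdist R) m).
Context (lT : is_linear T) (lT' : is_linear T').
Context (sigT : signature T = signature T').

Let fixes_ends (psi : R -> R) := [/\ psi 0 = 0, psi 1 = 1 &
  forall t, 0 <= t <= 1 -> 0 <= psi t <= 1].

(** The operator whose fixed points conjugate T to T'. *)
Let transport (psi : R -> R) (t : R) : R :=
  xget 0 [set u | exists (i : 'I_m) (s : R),
    [/\ 0 <= s <= 1, t = zmap T i s & u = zmap T' i (psi s)]].

(** Two different pieces can only meet in a common vertex, where equality of the
    signatures makes the two candidate values agree. *)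
Let transport_well_defined psi i j s u : fixes_ends psi ->
  0 <= s <= 1 -> 0 <= u <= 1 -> zmap T i s = zmap T j u ->
  zmap T' i (psi s) = zmap T' j (psi u).
Proof.
move=> [psi0 psi1 _].
have psi_end (e : bool) : psi e%:R = e%:R by case: e.
wlog: i j s u / (i <= j)%N.
  by move=> H s01 u01 su; have [ij|/ltnW ji] := leqP i j;
    [exact: H | apply/esym; exact: H].
rewrite leq_eqVlt => /orP[/eqP/val_inj->|ij] s01 u01 su.
  by rewrite (rdist_zmap_inj su).
have /andP[_ sh] := linear_zmap_piece i lT s01.
have /andP[lu _] := linear_zmap_piece j lT u01.
have hl := piece_disjoint lT ij.
have sE : zmap T i s = piece_hi T i.
  by apply/le_anti; rewrite sh su (le_trans hl).
have uE : zmap T j u = piece_lo T j.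
  by apply/le_anti; rewrite lu -su sE hl.
(* s and u are the ends of the unit interval sent to the common vertex *)
have se : s = (~~ signature T i)%:R.
  apply: (@rdist_zmap_inj _ _ T i); rewrite sE linear_zmap_end//.
  by case: (signature T i).
have ue : u = (signature T j)%:R.
  apply: (@rdist_zmap_inj _ _ T j); rewrite uE linear_zmap_end//.
  by case: (signature T j).
have adj : i.+1 = j by apply: (piece_adjacent lT ij); rewrite -sE -uE.
rewrite se ue !psi_end !linear_zmap_end// sigT.
by case: (signature T' i); case: (signature T' j); rewrite /= /piece_hi /piece_lo adj.
Qed.

Let transport_zmap psi i s : fixes_ends psi -> 0 <= s <= 1 ->
  transport psi (zmap T i s) = zmap T' i (psi s).
Proof.
move=> psiE s01.
suff [j [v [v01 sv]]] : exists (j : 'I_m) (v : R), [/\ 0 <= v <= 1,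
    zmap T i s = zmap T j v & transport psi (zmap T i s) = zmap T' j (psi v)].
  by move=> ->; apply/esym; exact: transport_well_defined.
have : exists u, exists (j : 'I_m) (v : R), [/\ 0 <= v <= 1,
    zmap T i s = zmap T j v & u = zmap T' j (psi v)].
  by exists (zmap T' i (psi s)), i, s.
exact: xgetPex.
Qed.

Let transport_fixes_ends psi : fixes_ends psi -> fixes_ends (transport psi).
Proof.
move=> psiE; have [psi0 psi1 psi01] := psiE.
have psi_end (e : bool) : psi e%:R = e%:R by case: e.
have m0 := linear_gt0 lT; have [T0 T1 _] := lT; have [T'0 T'1 _] := lT'.
have first_lo (U : zipper (@rdist R) m) : is_linear U ->
    zmap U (Ordinal m0) (signature U (Ordinal m0))%:R = 0.
  move=> lU; rewrite linear_zmap_end//; case: lU => <- _ _.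
  by rewrite addbb /piece_lo; congr vertex; apply: val_inj; rewrite /= inordK.
have m1 : (m.-1 < m)%N by rewrite prednK.
have last_hi (U : zipper (@rdist R) m) : is_linear U ->
    zmap U (Ordinal m1) (~~ signature U (Ordinal m1))%:R = 1.
  move=> lU; rewrite linear_zmap_end// addNb addbb; case: lU => _ <- _.
  by rewrite /piece_hi; congr vertex; apply: val_inj; rewrite /= prednK// inordK.
split.
- by rewrite -[in LHS](first_lo T)// transport_zmap ?bool01// psi_end sigT first_lo.
- by rewrite -[in LHS](last_hi T)// transport_zmap ?bool01// psi_end sigT last_hi.
- move=> t /(linear_cover lT)[i [s [s01 ->]]].
  by rewrite transport_zmap//; apply: linear_zmap01 => //; exact: psi01.
Qed.

Let iterate k : R -> R := iter k transport id.

Let iterate_fixes_ends k : fixes_ends (iterate k).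
Proof. by elim: k => [//|k IH]; exact: transport_fixes_ends. Qed.

(** The operator contracts the sup distance by any bound rho on the ratios of T',
    and the initial functions take values in the unit interval. *)
Let iterate_cauchy rho k j t : 0 <= rho < 1 ->
  (forall i, sim_ratio T' i <= rho) -> 0 <= t <= 1 ->
  `|iterate (k + j) t - iterate k t| <= rho ^+ k.
Proof.
move=> rho01 hrho; elim: k t => [|k IH] t t01.
  have [_ _ /(_ t t01)/andP[? ?]] := iterate_fixes_ends j.
  by move: t01 => /andP[? ?]; rewrite expr0 ler_norml (_ : iterate 0 t = t)// add0n; lra.
have [i [s [s01 ->]]] := linear_cover lT t01.
rewrite addSn /iterate !iterS !transport_zmap//; try exact: iterate_fixes_ends.
rewrite rdist_zmap_dist exprS; apply: ler_pM => //; last exact: IH.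
by have /andP[/ltW] := sim_ratio_bounds T' i.
Qed.

(** The limit of the iterates conjugates T to T'; it is obtained as the supremum of the
    lower bounds iterate k t - rho ^+ k. *)
Lemma linear_conjugation_exists : exists psi : R -> R,
  (forall t, 0 <= t <= 1 -> 0 <= psi t <= 1) /\
  (forall i t, 0 <= t <= 1 -> psi (zmap T i t) = zmap T' i (psi t)).
Proof.
have [rho rho01 hrho] := sim_ratio_lt1_unif T'.
have /andP[rho0 rho1] := rho01.
have cauchy j k t : 0 <= t <= 1 ->
    iterate j t - rho ^+ j <= iterate k t + rho ^+ k.
  move=> t01; have [jk|/ltnW kj] := leqP j k.
    have := iterate_cauchy j (k - j) rho01 hrho t01; rewrite subnKC//.
    by rewrite ler_norml => /andP[]; have := exprn_ge0 k rho0; lra.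
  have := iterate_cauchy k (j - k) rho01 hrho t01; rewrite subnKC//.
  by rewrite ler_norml => /andP[]; have := exprn_ge0 j rho0; lra.
pose lower t := range (fun k => iterate k t - rho ^+ k).
have lower0 t : lower t !=set0 by exists (iterate 0 t - rho ^+ 0), 0%N.
have near_limit k t : 0 <= t <= 1 ->
    `|sup (lower t) - iterate k t| <= rho ^+ k.
  move=> t01; rewrite ler_distl; apply/andP; split.
    apply: ub_le_sup; last by exists k.
    by exists (iterate 0 t + rho ^+ 0) => _ [j _ <-]; exact: cauchy.
  by apply: ge_sup => // _ [j _ <-]; exact: cauchy.
exists (fun t => sup (lower t)); split=> [t t01|i t t01].
  apply/andP; split; rewrite leNgt; apply/negP => out.
  - have [|k] := expr_lt_eps rho01 (_ : 0 < - sup (lower t)).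
      by rewrite oppr_gt0.
    have [_ _ /(_ t t01)/andP[? ?]] := iterate_fixes_ends k.
    by have := near_limit k t t01; rewrite ler_distl => /andP[]; lra.
  - have [|k] := expr_lt_eps rho01 (_ : 0 < sup (lower t) - 1).
      by rewrite subr_gt0.
    have [_ _ /(_ t t01)/andP[? ?]] := iterate_fixes_ends k.
    by have := near_limit k t t01; rewrite ler_distl => /andP[]; lra.
apply: (eq_of_le_expr rho01 (_ : 0 < 2)) => // k.
have limT := near_limit k.+1 _ (linear_zmap01 i lT t01).
have limT' : `|iterate k.+1 (zmap T i t) - zmap T' i (sup (lower t))| <= rho ^+ k.
  rewrite /iterate iterS transport_zmap//; last exact: iterate_fixes_ends.
  rewrite rdist_zmap_dist distrC; apply: le_trans (near_limit k t t01).
  rewrite ler_piMl//; have /andP[_ /ltW] := sim_ratio_bounds T' i; exact.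
apply: le_trans (ler_distD (iterate k.+1 (zmap T i t)) _ _) _.
have : rho ^+ k.+1 <= rho ^+ k by rewrite exprS ler_piMl ?exprn_ge0// ltW.
by move: limT limT'; lra.
Qed.

End linear_conjugation.

Lemma linear_selfconjugation_unique (R : realType) (m : nat)
    (T : zipper (@rdist R) m) (chi : R -> R) : is_linear T ->
  (forall t, 0 <= t <= 1 -> 0 <= chi t <= 1) ->
  (forall i t, 0 <= t <= 1 -> chi (zmap T i t) = zmap T i (chi t)) ->
  forall t, 0 <= t <= 1 -> chi t = t.
Proof.
move=> lT chi01 chiT t t01; have [rho rho01 hrho] := sim_ratio_lt1_unif T.
apply: (eq_of_le_expr rho01 (ltr01)) => k; rewrite mul1r.
elim: k t t01 => [|k IH] t t01.
  have /andP[? ?] := chi01 t t01; have /andP[? ?] := t01.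
  by rewrite expr0 ler_norml; lra.
have [i [s [s01 ->]]] := linear_cover lT t01.
rewrite chiT// rdist_zmap_dist exprS; apply: ler_pM => //; last exact: IH.
by have /andP[/ltW] := sim_ratio_bounds T i.
Qed.

(** * The signature is a conjugation invariant *)

Lemma linear_zmap_lt (R : realType) (m : nat) (T : zipper (@rdist R) m) (i : 'I_m)
    (s t : R) : is_linear T -> 0 <= s <= 1 -> 0 <= t <= 1 -> s < t ->
  (zmap T i s < zmap T i t) = ~~ signature T i.
Proof.
move=> lT s01 t01 st; have lh := piece_lt i lT.
rewrite (rdist_zmap_affine _ _ s01) (rdist_zmap_affine _ _ t01).
rewrite linear_zmap0// linear_zmap1//; case: (signature T i) => /=.
  by apply/negbTE; rewrite -leNgt; nra.
by nra.
Qed.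

(** A continuous injection of an interval is strictly monotone, and conjugation by
    it preserves the orientation of each map, whether it increases or
    decreases. *)
Lemma signature_eq_of_conjugation (R : realType) (m : nat)
    (T T' : zipper (@rdist R) m) (phi : R -> R) :
  is_linear T -> is_linear T' ->
  {within `[0, 1], continuous phi} -> {in `[0, 1] &, injective phi} ->
  (forall t, 0 <= t <= 1 -> 0 <= phi t <= 1) ->
  (forall i t, 0 <= t <= 1 -> phi (zmap T i t) = zmap T' i (phi t)) ->
  signature T = signature T'.
Proof.
move=> lT lT' cphi iphi phi01 phiT; apply/ffunP => i; apply: negb_inj.
have I0 : 0 <= (0 : R) <= 1 by rewrite lexx ler01.
have I1 : 0 <= (1 : R) <= 1 by rewrite lexx ler01.
have T0 := linear_zmap01 i lT I0; have T1 := linear_zmap01 i lT I1.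
rewrite -(linear_zmap_lt i lT I0 I1 ltr01).
have [mono|mono] := itv_continuous_inj_mono cphi iphi.
- have phi_lt : phi 0 < phi 1 by rewrite (leW_mono_in (le_mono_in mono)) ?in_itv.
  rewrite -(linear_zmap_lt i lT' (phi01 _ I0) (phi01 _ I1) phi_lt).
  by rewrite -!phiT// (leW_mono_in (le_mono_in mono)) ?in_itv.
- have phi_lt : phi 1 < phi 0 by rewrite (leW_nmono_in (le_nmono_in mono)) ?in_itv.
  rewrite -(linear_zmap_lt i lT' (phi01 _ I1) (phi01 _ I0) phi_lt).
  by rewrite -!phiT// (leW_nmono_in (le_nmono_in mono)) ?in_itv.
Qed.

(** * The exponent *)

Lemma holder_exponentC (R : realType) (m : nat) (p q : 'I_m -> R) :
  holder_exponent p q = holder_exponent q p.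
Proof. by apply: eq_bigr => i _; rewrite minC. Qed.

Lemma holder_exponent_gt0 (R : realType) (m : nat) (p q : 'I_m -> R) :
  (forall i, 0 < p i < 1) -> (forall i, 0 < q i < 1) -> 0 < holder_exponent p q.
Proof.
move=> p01 q01; apply: lt_bigmin => // i _.
have lp := ln_lt0 (p01 i); have lq := ln_lt0 (q01 i).
by rewrite lt_min !ltr_ndivlMr// !mul0r lp lq.
Qed.

(** Since ln (p i) < 0, the bound alpha <= ln (q i) / ln (p i) turns into
    ln (q i) <= alpha * ln (p i). *)
Lemma ratio_le_powR_exponent (R : realType) (m : nat) (p q : 'I_m -> R) (i : 'I_m) :
  0 < p i < 1 -> 0 < q i < 1 -> q i <= p i `^ holder_exponent p q.
Proof.
move=> pi01 qi01; have /andP[p0 _] := pi01; have /andP[q0 _] := qi01.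
rewrite /powR gt_eqF// -[leLHS]lnK ?posrE// ler_expR.
rewrite -ler_ndivlMr ?ln_lt0//.
by apply: le_trans (bigmin_le _ i _) _; rewrite ge_min lexx orbT.
Qed.

(** * Transfer to the attractors *)

Lemma structural_data (R : realType) (n m : nat) (S : zipper (@eucl_dist R n) m)
    (gamma : set 'rV[R]_n) : jordan_zipper S gamma ->
  exists (T : zipper (@rdist R) m) (g : R -> 'rV[R]_n) (h : 'rV[R]_n -> R),
    [/\ is_linear T, signature T = signature S,
      (forall i (t : R), 0 <= t <= 1 -> zmap S i (g t) = g (zmap T i t)) &
      [/\ homeo (`[0, 1] : set R) gamma g h,
        (forall t : R, 0 <= t <= 1 -> gamma (g t) /\ h (g t) = t) &
        (forall x, gamma x -> 0 <= h x <= 1 /\ g (h x) = x)]].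
Proof.
move=> [T [g [h [[lT sT cg _ gT] hom]]]]; exists T, g, h.
by have [gh hg _ _] := hom; split.
Qed.

(** The subarc with endpoints g s and g t contains g s' and g t', so its diameter
    bounds their distance. *)
Lemma turning_along_parametrization (R : realType) (n : nat)
    (gamma : set 'rV[R]_n) (g : R -> 'rV[R]_n) (h : 'rV[R]_n -> R) :
  bounded_turning gamma -> homeo (`[0, 1] : set R) gamma g h ->
  exists2 M : R, 0 < M & forall s s' t' t : R, 0 <= s -> s <= s' -> s' <= t' ->
    t' <= t -> t <= 1 -> eucl_dist (g s') (g t') <= M * eucl_dist (g s) (g t).
Proof.
move=> [M M0 turn] hom; exists M => // s s' t' t s0 ss' st' tt' t1.
have [gh _ _ _] := hom; have s't := le_trans st' tt'; have st := le_trans ss' s't.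
have gam u : 0 <= u -> u <= 1 -> gamma (g u).
  by move=> u0 u1; apply: (gh u _).1; rewrite /= in_itv/= u0.
have sub : subarc gamma (g s) (g t) (g @` `[s, t]).
  by exists g, h, s, t; rewrite s0 st.
have := turn _ _ _ (gam s s0 (le_trans st t1)) (gam t (le_trans s0 st) t1) sub.
rewrite -lee_fin; apply: le_trans; apply: ereal_sup_ubound.
exists (g s', g t') => //; split=> /=.
  by exists s' => //; rewrite /= in_itv/= ss'.
by exists t' => //; rewrite /= in_itv/= (le_trans ss').
Qed.

(** If g parametrizes gamma compatibly with S and T, then f o g intertwines the same
    linear zipper T with S'. *)
Lemma holder_of_agreeing (R : realType) (n m : nat)
    (S S' : zipper (@eucl_dist R n) m) (gamma gamma' : set 'rV[R]_n)
    (f : 'rV[R]_n -> 'rV[R]_n) (a : R) :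
  jordan_zipper S gamma -> bounded_turning gamma -> compact gamma' ->
  (forall x, gamma x -> gamma' (f x)) -> agrees S S' gamma f ->
  0 < a -> (forall i, sim_ratio S' i <= sim_ratio S i `^ a) ->
  holder a gamma f.
Proof.
move=> /structural_data[T [g [h [lT _ gT [hom gh hg]]]]] turn compact' fgamma fS a0 ra.
have [M M0 turn_g] := turning_along_parametrization turn hom.
have [D D0 HD] := compact_eucl_bounded compact'.
have I0 : 0 <= (0 : R) <= 1 by rewrite lexx ler01.
have I1 : 0 <= (1 : R) <= 1 by rewrite lexx ler01.
have [C C0 HC] : exists2 C, 0 < C & forall s t : R, 0 <= s <= 1 -> 0 <= t <= 1 ->
    eucl_dist ((f \o g) s) ((f \o g) t) <= C * eucl_dist (g s) (g t) `^ a.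
  apply: (@holder_of_intertwining _ _ _ S S' T g (f \o g) M D a) => //.
  - by move=> i t t01 /=; rewrite -fS ?gT//; exact: (gh t t01).1.
  - by move=> s t /gh[gs _] /gh[gt _]; apply: HD; exact: fgamma.
  - apply/eqP => /(congr1 h); rewrite (gh 0 I0).2 (gh 1 I1).2 => /esym/eqP.
    by rewrite oner_eq0.
split=> //; exists C => // x y /hg[hx01 ghx] /hg[hy01 ghy].
by rewrite -{1 2}ghx -{1 2}ghy; have := HC _ _ hx01 hy01; rewrite /= ghx ghy.
Qed.

(** The topology is that of the sup norm, whose equivalence with the Euclidean
    norm has to be used on both sides. *)
Lemma holder_within_continuous (R : realType) (n : nat) (A : set 'rV[R]_n)
    (f : 'rV[R]_n -> 'rV[R]_n) (a : R) :
  holder a A f -> {within A, continuous f}.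
Proof.
move=> [a0 [C C0 hold]]; apply/subspace_continuousP => x Ax.
apply/cvgrPdist_lt => e e0.
pose K : R := Num.sqrt n%:R + 1.
have K0 : 0 < K by rewrite ltr_wpDl ?sqrtr_ge0.
pose r := (e / C) `^ a^-1.
have r0 : 0 < r by rewrite powR_gt0// divr_gt0.
have : \forall y \near x, `|x - y| < r / K.
  have /cvgrPdist_lt : (y @[y --> x] --> x)%classic by exact: cvg_id.
  by apply; rewrite divr_gt0.
apply: filterS => y /= xy Ay.
apply: le_lt_trans (normr_le_eucl_dist _ _) _.
apply: le_lt_trans (hold _ _ Ax Ay) _; rewrite mulrC -ltr_pdivlMr//.
have -> : e / C = r `^ a.
  by rewrite /r -powRrM mulVf ?gt_eqF// powRr1// ltW// divr_gt0.
apply: gt0_ltr_powR => //; rewrite ?nnegrE ?eucl_dist_ge0// ?ltW//.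
apply: le_lt_trans (eucl_dist_le_normr _ _) _.
apply: (@le_lt_trans _ _ (K * `|x - y|)); first by rewrite ler_wpM2r// lerDl.
by rewrite mulrC -ltr_pdivlMr.
Qed.

Lemma within_continuous_compS (X Y Z : topologicalType) (A : set X) (B : set Y)
    (f : X -> Y) (g : Y -> Z) : (forall x, A x -> B (f x)) ->
  {within A, continuous f} -> {within B, continuous g} ->
  {within A, continuous (g \o f)}.
Proof.
move=> AB /subspace_continuousP cf /subspace_continuousP cg.
apply/subspace_continuousP => x Ax U /(cg _ (AB _ Ax)) /(cf _ Ax).
move=> H; have {}H : nbhs x [set y | A y -> B (f y) -> U (g (f y))] := H.
suff : nbhs x [set y | A y -> U (g (f y))] by [].
by apply: filterS H => y h Ay; exact: h Ay (AB _ Ay).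
Qed.

(** The invariance of gamma under the maps of S, part of being an attractor, makes
    g (f (S_i x)) = S_i x available for x in gamma. *)
Lemma agrees_inverse (R : realType) (n m : nat)
    (S S' : zipper (@eucl_dist R n) m) (gamma gamma' : set 'rV[R]_n)
    (f g : 'rV[R]_n -> 'rV[R]_n) :
  is_attractor S gamma -> homeo gamma gamma' f g -> agrees S S' gamma f ->
  agrees S' S gamma' g.
Proof.
move=> [_ _ gammaE] [fg gf _ _] fS i y /gf[gy fgy].
rewrite -[in LHS]fgy -fS// (fg _ _).2// gammaE.
by exists i => //; exists (g y).
Qed.

Lemma holder_agreeing_homeo (R : realType) (n m : nat)
    (S S' : zipper (@eucl_dist R n) m) (gamma gamma' : set 'rV[R]_n)
    (f g : 'rV[R]_n -> 'rV[R]_n) :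
  is_attractor S gamma -> is_attractor S' gamma' ->
  jordan_zipper S gamma -> jordan_zipper S' gamma' ->
  bounded_turning gamma -> bounded_turning gamma' ->
  (forall x, gamma x -> gamma' (f x)) -> (forall y, gamma' y -> gamma (g y)) ->
  agrees S S' gamma f -> agrees S' S gamma' g ->
  holder (holder_exponent (sim_ratio S) (sim_ratio S')) gamma f /\
  holder (holder_exponent (sim_ratio S) (sim_ratio S')) gamma' g.
Proof.
move=> [_ cgamma _] [_ cgamma' _] jS jS' turn turn' fgamma ggamma' fS gS.
have a0 := holder_exponent_gt0 (sim_ratio_bounds S) (sim_ratio_bounds S').
split.
- apply: (@holder_of_agreeing _ _ _ S S' _ gamma') => // i.
  by apply: ratio_le_powR_exponent; exact: sim_ratio_bounds.
- apply: (@holder_of_agreeing _ _ _ S' S _ gamma) => // i.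
  by rewrite holder_exponentC; apply: ratio_le_powR_exponent; exact: sim_ratio_bounds.
Qed.

(** The map h' o f o g conjugates the linear zippers of S and S'. *)
Lemma signature_eq_of_agreeing (R : realType) (n m : nat)
    (S S' : zipper (@eucl_dist R n) m) (gamma gamma' : set 'rV[R]_n)
    (f finv : 'rV[R]_n -> 'rV[R]_n) :
  jordan_zipper S gamma -> jordan_zipper S' gamma' ->
  homeo gamma gamma' f finv -> agrees S S' gamma f -> signature S = signature S'.
Proof.
move=> /structural_data[T [g [h [lT <- gT [[_ _ cg _] gh hg]]]]].
move=> /structural_data[T' [g' [h' [lT' <- gT' [[_ _ _ ch'] gh' hg']]]]].
move=> [ffi fif cf _] fS.
have Iset (t : R) : [set` `[0, 1]] t -> 0 <= t <= 1 by rewrite /= in_itv.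
apply: (@signature_eq_of_conjugation _ _ _ _ (h' \o (f \o g))) => //.
- apply: (@within_continuous_compS _ _ _ _ gamma') => //.
    by move=> t /Iset/gh[/ffi[]].
  apply: (@within_continuous_compS _ _ _ _ gamma) => //.
  by move=> t /Iset/gh[].
- move=> s t /Iset s01 /Iset t01 /(congr1 g') /=.
  have [gs hs] := gh s s01; have [gt ht] := gh t t01.
  have [fs fis] := ffi _ gs; have [ft fit] := ffi _ gt.
  rewrite (hg' _ fs).2 (hg' _ ft).2 => /(congr1 finv).
  by rewrite fis fit => /(congr1 h); rewrite hs ht.
- by move=> t /gh[/ffi[/hg'[]]].
- move=> i t t01 /=; have [gt _] := gh t t01; have [fgt _] := ffi _ gt.
  have [h01 gh'E] := hg' _ fgt.
  rewrite -gT// fS// -[in LHS]gh'E gT'//.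
  by rewrite (gh' _ (linear_zmap01 i lT' h01)).2.
Qed.

(** Equal signatures give a conjugation psi of the linear zippers in each direction;
    the two are mutually inverse since a self-conjugation is the identity, so
    f = g' o psi o h is a bijection of the attractors. *)
Lemma agreeing_bijection_exists (R : realType) (n m : nat)
    (S S' : zipper (@eucl_dist R n) m) (gamma gamma' : set 'rV[R]_n) :
  jordan_zipper S gamma -> jordan_zipper S' gamma' ->
  signature S = signature S' ->
  exists f finv : 'rV[R]_n -> 'rV[R]_n,
    [/\ (forall x, gamma x -> gamma' (f x) /\ finv (f x) = x),
        (forall y, gamma' y -> gamma (finv y) /\ f (finv y) = y),
        agrees S S' gamma f & agrees S' S gamma' finv].
Proof.
move=> /structural_data[T [g [h [lT sT gT [_ gh hg]]]]].
move=> /structural_data[T' [g' [h' [lT' sT' gT' [_ gh' hg']]]]] sig.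
have sigT : signature T = signature T' by rewrite sT sT'.
have [psi [psi01 psiT]] := linear_conjugation_exists lT lT' sigT.
have [psi' [psi'01 psi'T]] := linear_conjugation_exists lT' lT (esym sigT).
have psiK t : 0 <= t <= 1 -> psi' (psi t) = t.
  apply: (@linear_selfconjugation_unique _ _ T (psi' \o psi)) => //.
    by move=> u /psi01/psi'01.
  by move=> i u u01 /=; rewrite psiT// psi'T//; exact: psi01.
have psi'K t : 0 <= t <= 1 -> psi (psi' t) = t.
  apply: (@linear_selfconjugation_unique _ _ T' (psi \o psi')) => //.
    by move=> u /psi'01/psi01.
  by move=> i u u01 /=; rewrite psi'T// psiT//; exact: psi'01.
exists (g' \o (psi \o h)), (g \o (psi' \o h')); split.
- move=> x /hg[h01 ghx] /=; have [gp hp] := gh' _ (psi01 _ h01).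
  by rewrite hp psiK.
- move=> y /hg'[h01 ghy] /=; have [gp hp] := gh _ (psi'01 _ h01).
  by rewrite hp psi'K.
- move=> i x /hg[h01 ghx] /=.
  rewrite -[in LHS]ghx gT// (gh _ (linear_zmap01 i lT h01)).2 psiT//.
  by rewrite gT'//; exact: psi01.
- move=> i y /hg'[h01 ghy] /=.
  rewrite -[in LHS]ghy gT'// (gh' _ (linear_zmap01 i lT' h01)).2 psi'T//.
  by rewrite gT//; exact: psi'01.
Qed.

(** * The isomorphism theorem *)

Unset Implicit Arguments.

Theorem theorem1 (R : realType) (n m : nat) (S S' : zipper (@eucl_dist R n) m)
    (gamma gamma' : set 'rV[R]_n)
    (hK : is_attractor S gamma) (hK' : is_attractor S' gamma')
    (hJ : jordan_zipper S gamma) (hJ' : jordan_zipper S' gamma')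
    (hA : jordan_arc gamma) (hA' : jordan_arc gamma')
    (hB : bounded_turning gamma) (hB' : bounded_turning gamma') :
  let alpha := holder_exponent (sim_ratio S) (sim_ratio S') in
  (bi_holder_isomorphic S S' gamma gamma' <-> signature S = signature S') /\
  (signature S = signature S' ->
   forall f g : 'rV[R]_n -> 'rV[R]_n,
     homeo gamma gamma' f g -> agrees S S' gamma f ->
     holder alpha gamma f /\ holder alpha gamma' g).
Proof.
move=> alpha; split; last first.
  move=> _ f g hom fS; have [fg gf _ _] := hom.
  apply: holder_agreeing_homeo => //.
  - by move=> x /fg[].
  - by move=> y /gf[].
  - exact: agrees_inverse hom fS.
split=> [[f [g [hom fS _ _]]]|sig].
  exact: signature_eq_of_agreeing hom fS.
have [f [g [fg gf fS gS]]] := agreeing_bijection_exists hJ hJ' sig.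
have [hf hg] : holder alpha gamma f /\ holder alpha gamma' g.
  apply: holder_agreeing_homeo => //.
  - by move=> x /fg[].
  - by move=> y /gf[].
exists f, g; split=> //; [|by exists alpha|by exists alpha].
by split=> //; [exact: holder_within_continuous hf |
  exact: holder_within_continuous hg].
Qed.
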